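(* Let $\varepsilon>0$, $\underline{a}>0$, $\underline{u}\in\mathbb{R}$ be constants, let $N$ be the number of mesh cells and $\Delta x>0$ the mesh size, with periodic boundary conditions (indices $i$ taken modulo $N$). Consider an $s$-stage IMEX-RK scheme which is of type-A or type-CK. Suppose a discrete numerical approximation $U^n_i=(\varrho^n_i,u^n_i)\in\mathbb{R}^2$, $i=1,\dots,N$, at time $t^n$ and a timestep $\Delta t>0$ are given, and set $\lambda_1:=\Delta t/\Delta x$. Then each of the intermediate stages $$U^k_i=U^n_i-\lambda_1\sum_{\ell=1}^{k-1}\tilde a_{k,\ell}\bigl(\mathcal{F}_{i+\frac12}(U^\ell)-\mathcal{F}_{i-\frac12}(U^\ell)\bigr)-\lambda_1\sum_{l=1}^{k}a_{k,l}\bigl(\mathcal{G}_{i+\frac12}(U^l)-\mathcal{G}_{i-\frac12}(U^l)\bigr),\quad i=1,\dots,N,$$ admits a unique solution $U^k_i=(\varrho^k_i,u^k_i)$ for $k=1,2,\dots,s$. As a consequence, the update step $$U^{n+1}_i=U^n_i-\lambda_1\sum_{k=1}^{s}\tilde\omega_k\bigl(\mathcal{F}_{i+\frac12}(U^k)-\mathcal{F}_{i-\frac12}(U^k)\bigr)-\lambda_1\sum_{k=1}^{s}\omega_k\bigl(\mathcal{G}_{i+\frac12}(U^k)-\mathcal{G}_{i-\frac12}(U^k)\bigr),\quad i=1,\dots,N,$$ admits a unique solution $(\varrho^{n+1}_i,u^{n+1}_i)$ at time $t^{n+1}=t^n+\Delta t$.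
   Context: The scheme discretises the one-dimensional linear wave equation system $\partial_t\varrho+\underline{u}\,\partial_x\varrho+\frac{\underline{a}}{\varepsilon}\partial_x u=0$, $\partial_t u+\underline{u}\,\partial_x u+\frac{\underline{a}}{\varepsilon}\partial_x\varrho=0$ on a periodic domain, with $U=(\varrho,u)$, non-stiff flux $F(U)=\underline{u}\,U$ and stiff flux $G(U)=\frac{\underline{a}}{\varepsilon}(u,\varrho)$. The numerical fluxes are $$\mathcal{F}_{i+\frac12}(U)=\tfrac12\bigl(F(U^+_{i+\frac12})+F(U^-_{i+\frac12})\bigr)-\tfrac{\underline{u}}{2}\bigl(U^+_{i+\frac12}-U^-_{i+\frac12}\bigr),\qquad \mathcal{G}_{i+\frac12}(U)=\tfrac12\bigl(G(U_{i+1})+G(U_i)\bigr),$$ where $U^{\pm}_{i+\frac12}$ are the right and left interpolated states at the interface $i+\frac12$ obtained by piecewise linear reconstruction with central-difference slopes and no limiters: $U^-_{i+\frac12}=U_i+\frac14(U_{i+1}-U_{i-1})$ and $U^+_{i+\frac12}=U_{i+1}-\frac14(U_{i+2}-U_i)$. An $s$-stage IMEX-RK scheme (diagonally implicit) has $s\times s$ real matrices $\tilde A=(\tilde a_{i,j})$ with $\tilde a_{i,j}=0$ for $j\ge i$, and $A=(a_{i,j})$ with $a_{i,j}=0$ for $j>i$, and weights $\tilde\omega,\omega\in\mathbb{R}^s$. It is of type-A if $A$ is invertible. It is of type-CK if $s\ge2$ and $A=\begin{pmatrix}0&0\\ \alpha&A_{s-1}\end{pmatrix}$ with $\alpha\in\mathbb{R}^{s-1}$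 and $A_{s-1}\in\mathbb{R}^{(s-1)\times(s-1)}$ invertible. *)

(* Defs.v *)
From HB Require Import structures.
From mathcomp Require Import all_boot all_order all_algebra.
From mathcomp Require Import reals.
Set Implicit Arguments.
Unset Strict Implicit.
Unset Printing Implicit Defensive.
Import Order.TTheory GRing.Theory Num.Theory.
Local Open Scope ring_scope.

(* A state is the pair U = (rho, u); the copies R^o make the product a vector
   space over R. *)
Notation state R := (R^o * R^o)%type.

(* Cells are indexed by 0, ..., N-1 instead of 1, ..., N; the indices i+1 and
   i-1 modulo N are ordS i and ord_pred i. *)
Notation grid_fun R N := {ffun 'I_N -> state R}.

Definition flux_F (R : realType) (ubar : R) (U : state R) : state R :=
  ubar *: U.

Definition flux_G (R : realType) (eps abar : R) (U : state R) : state R :=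
  (abar / eps) *: ((U.2, U.1) : state R).

(* Quantities at the interface i+1/2 carry the index i, so those at the
   interface i-1/2 carry the index ord_pred i. *)
Definition left_state (R : realType) (N : nat) (U : grid_fun R N) (i : 'I_N) :
    state R :=
  U i + 4^-1 *: (U (ordS i) - U (ord_pred i)).

Definition right_state (R : realType) (N : nat) (U : grid_fun R N) (i : 'I_N) :
    state R :=
  U (ordS i) - 4^-1 *: (U (ordS (ordS i)) - U i).

Definition num_flux_F (R : realType) (ubar : R) (N : nat) (U : grid_fun R N)
    (i : 'I_N) : state R :=
  2^-1 *: (flux_F ubar (right_state U i) + flux_F ubar (left_state U i))
  - (ubar / 2) *: (right_state U i - left_state U i).

Definition num_flux_G (R : realType) (eps abar : R) (N : nat)
    (U : grid_fun R N) (i : 'I_N) : state R :=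
  2^-1 *: (flux_G eps abar (U (ordS i)) + flux_G eps abar (U i)).

Definition flux_diff_F (R : realType) (ubar : R) (N : nat) (U : grid_fun R N)
    (i : 'I_N) : state R :=
  num_flux_F ubar U i - num_flux_F ubar U (ord_pred i).

Definition flux_diff_G (R : realType) (eps abar : R) (N : nat)
    (U : grid_fun R N) (i : 'I_N) : state R :=
  num_flux_G eps abar U i - num_flux_G eps abar U (ord_pred i).

Record imex_rk (R : realType) (s : nat) := ImexRK {
  rk_At : 'M[R]_s;
  rk_A : 'M[R]_s;
  rk_wt : 'rV[R]_s;
  rk_w : 'rV[R]_s;
  rk_At_explicit : forall k l : 'I_s, (k <= l)%N -> rk_At k l = 0;
  rk_A_diag_implicit : forall k l : 'I_s, (k < l)%N -> rk_A k l = 0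
}.

Definition type_A (R : realType) (s : nat) (S : imex_rk R s) : Prop :=
  rk_A S \in unitmx.

(* The equation 1 + m = s is needed only to compare the block matrix with the
   s x s matrix of the scheme. *)
Definition type_CK (R : realType) (s : nat) (S : imex_rk R s) : Prop :=
  (2 <= s)%N /\
  exists (m : nat) (e : (1 + m)%N = s) (alpha : 'cV[R]_m) (A' : 'M[R]_m),
    rk_A S = castmx (e, e) (block_mx 0 0 alpha A') /\ A' \in unitmx.

(* W k is the k-th stage; stages are indexed by 0, ..., s-1. *)
Notation stage_fun R N s := {ffun 'I_s -> grid_fun R N}.

Definition stage_eq (R : realType) (eps abar ubar lambda1 : R) (N s : nat)
    (S : imex_rk R s) (Un : grid_fun R N) (W : stage_fun R N s) (k : 'I_s) :
    Prop :=
  forall i : 'I_N,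
    W k i = Un i
      - lambda1 *: (\sum_(l < s | (l < k)%N)
                      rk_At S k l *: flux_diff_F ubar (W l) i)
      - lambda1 *: (\sum_(l < s | (l <= k)%N)
                      rk_A S k l *: flux_diff_G eps abar (W l) i).

Definition update_eq (R : realType) (eps abar ubar lambda1 : R) (N s : nat)
    (S : imex_rk R s) (Un : grid_fun R N) (W : stage_fun R N s)
    (Unext : grid_fun R N) : Prop :=
  forall i : 'I_N,
    Unext i = Un i
      - lambda1 *: (\sum_(k < s) rk_wt S 0 k *: flux_diff_F ubar (W k) i)
      - lambda1 *: (\sum_(k < s) rk_w S 0 k *: flux_diff_G eps abar (W k) i).

Definition set_stage (R : realType) (N s : nat) (W : stage_fun R N s)
    (k : 'I_s) (V : grid_fun R N) : stage_fun R N s :=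
  [ffun l => if l == k then V else W l].

(* Main.v *)
(* Only the diagonal term of the stage equation is implicit, so stage k amounts
   to a linear system (1 + mu D) V = B, where D is the central difference of the
   stiff flux and B depends on the earlier stages alone. Since the flux matrix
   is symmetric and the central difference is skew-symmetric on a periodic grid,
   D is skew-adjoint: V + mu D V = 0 gives <V, V> = - mu <V, D V> = 0. Hence
   1 + mu D is injective, and bijective by finite dimension, for every real mu,
   zero included. *)
Require Import Defs.
From HB Require Import structures.
From mathcomp Require Import all_boot all_order all_algebra.
From mathcomp Require Import reals.
From mathcomp Require Import ring.
Set Implicit Arguments.
Unset Strict Implicit.
Unset Printing Implicit Defensive.
Import Order.TTheory GRing.Theory Num.Theory.
Local Open Scope ring_scope.

(** Bundled as a map between grid functions so that it can carry a linear structure and enter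
    [linfun]. *)
Definition flux_diff_G_fun (R : realType) (eps abar : R) (N : nat)
    (V : grid_fun R N) : grid_fun R N :=
  [ffun i => flux_diff_G eps abar V i].

(** The averages at the two interfaces of cell [i] share the flux of [V i], which cancels. *)
Lemma flux_diff_GE (R : realType) (eps abar : R) (N : nat) (V : grid_fun R N)
    (i : 'I_N) :
  flux_diff_G eps abar V i =
    (abar / eps / 2) *: (((V (ordS i)).2 - (V (ord_pred i)).2,
                          (V (ordS i)).1 - (V (ord_pred i)).1) : state R).
Proof.
rewrite /flux_diff_G /num_flux_G /flux_G ord_predK.
by congr pair; rewrite /= /GRing.scale /=; ring.
Qed.

Lemma flux_diff_G_fun_is_linear (R : realType) (eps abar : R) (N : nat) :
  linear (@flux_diff_G_fun R eps abar N).
Proof.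
move=> a V W; apply/ffunP => i; rewrite !(ffunE, flux_diff_GE).
by congr pair; rewrite /= /GRing.scale /=; ring.
Qed.

HB.instance Definition _ (R : realType) (eps abar : R) (N : nat) :=
  GRing.isLinear.Build R (grid_fun R N) (grid_fun R N) _ _
    (@flux_diff_G_fun_is_linear R eps abar N).

Definition state_dot (R : realType) (U V : state R) : R :=
  let (rhoU, uU) := (U : R * R) in let (rhoV, uV) := (V : R * R) in
  rhoU * rhoV + uU * uV.

Lemma state_dotZr (R : realType) (a : R) (U V : state R) :
  state_dot U (a *: V) = a * state_dot U V.
Proof. by case: U V => [? ?] [? ?]; rewrite /= /GRing.scale /=; ring. Qed.

Lemma state_dot_ge0 (R : realType) (U : state R) : 0 <= state_dot U U.
Proof. by case: U => rho u; rewrite /= -!expr2 addr_ge0 ?sqr_ge0. Qed.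

Lemma state_dot_eq0 (R : realType) (U : state R) : state_dot U U = 0 -> U = 0.
Proof.
case: U => rho u /= /eqP.
rewrite -!expr2 paddr_eq0 ?sqr_ge0 // !sqrf_eq0 => /andP[/eqP rho0 /eqP u0].
by rewrite rho0 u0.
Qed.

Lemma flux_diff_G_skew (R : realType) (eps abar : R) (N : nat)
    (V : grid_fun R N) :
  \sum_i state_dot (V i) (flux_diff_G eps abar V i) = 0.
Proof.
pose h (i j : 'I_N) := state_dot (V i) ((V j).2, (V j).1).
(* Summation by parts: a cyclic shift turns [h i (ord_pred i)] into [h (ordS i) i], and [h] is
   symmetric because exchanging the two components is a symmetric matrix. *)
have hC : \sum_i h i (ord_pred i) = \sum_i h i (ordS i).
  rewrite (reindex_inj (@ordS_inj N)) /=; apply: eq_bigr => i _.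
  by rewrite ordSK /h; case: (V i) (V (ordS i)) => [? ?] [? ?] /=; ring.
transitivity (abar / eps / 2 *
    (\sum_i h i (ordS i) - \sum_i h i (ord_pred i))).
  rewrite -sumrB mulr_sumr; apply: eq_bigr => i _.
  rewrite flux_diff_GE state_dotZr /h; congr (_ * _).
  by case: (V i) => ? ? /=; ring.
by rewrite hC subrr mulr0.
Qed.

Lemma add_flux_diff_G_eq0 (R : realType) (eps abar mu : R) (N : nat)
    (V : grid_fun R N) :
  V + mu *: flux_diff_G_fun eps abar V = 0 -> V = 0.
Proof.
move=> V0.
have VE i : V i = (- mu) *: flux_diff_G eps abar V i.
  move/ffunP/(_ i): V0; rewrite !ffunE => /eqP.
  by rewrite addr_eq0 scaleNr => /eqP.
have norm0 : \sum_i state_dot (V i) (V i) = 0.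
  transitivity (- mu * \sum_i state_dot (V i) (flux_diff_G eps abar V i)).
    by rewrite mulr_sumr; apply: eq_bigr => i _; rewrite -state_dotZr -VE.
  by rewrite flux_diff_G_skew mulr0.
apply/ffunP => i; rewrite ffunE; apply: state_dot_eq0.
by apply: (psumr_eq0P _ norm0) => // j _; apply: state_dot_ge0.
Qed.

Lemma implicit_flux_solvable (R : realType) (eps abar mu : R) (N : nat)
    (B : grid_fun R N) :
  exists! V, V + mu *: flux_diff_G_fun eps abar V = B.
Proof.
pose f : 'End(grid_fun R N) :=
  (\1 + mu *: linfun (@flux_diff_G_fun R eps abar N))%VF.
have fE V : f V = V + mu *: flux_diff_G_fun eps abar V.
  by rewrite add_lfunE id_lfunE scale_lfunE lfunE.
have f_inj : lker f == 0%VS.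
  rewrite -subv0; apply/subvP => V; rewrite memv_ker memv0 fE => /eqP.
  by move/add_flux_diff_G_eq0/eqP.
(* For an endomorphism in finite dimension, a trivial kernel makes [f^-1] a two-sided inverse: one
   side gives existence, the other uniqueness. *)
exists (f^-1%VF B); split; first by rewrite -fE lker0_lfunVK.
by move=> V <-; rewrite -fE lker0_lfunK.
Qed.

(** Forward substitution: by [Pext] equation [k] reads only the stages up to [k], and by [Pk] it
    determines stage [k] once the others are fixed. *)
Lemma triangular_system_solvable (R : realType) (N s : nat)
    (P : stage_fun R N s -> 'I_s -> Prop)
    (Pext : forall (W W' : stage_fun R N s) (k : 'I_s),
      (forall l : 'I_s, (l <= k)%N -> W l = W' l) -> P W k -> P W' k)
    (Pk : forall (k : 'I_s) W, exists! V, P (set_stage W k V) k) :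
  exists! W, forall k, P W k.
Proof.
have partial n : (n <= s)%N -> exists W, forall k : 'I_s, (k < n)%N -> P W k.
  elim: n => [|n IHn] lt_ns; first by exists 0.
  have [W PW] := IHn (ltnW lt_ns); have [V [PV _]] := Pk (Ordinal lt_ns) W.
  exists (set_stage W (Ordinal lt_ns) V) => k.
  rewrite ltnS leq_eqVlt => /predU1P[kn|lt_kn].
    by have -> : k = Ordinal lt_ns by apply: val_inj.
  (* Overwriting stage [n] leaves the equations of earlier stages intact. *)
  apply: Pext (PW k lt_kn) => l le_lk; rewrite ffunE.
  by case: eqP le_lk => // ->; rewrite leqNgt lt_kn.
have [W PW] := partial s (leqnn s).
exists W; split=> [k|W' PW']; first exact: PW.
apply/ffunP; suff eqWW' n (k : 'I_s) : (k < n)%N -> W k = W' k.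
  by move=> k; apply: eqWW' (ltn_ord k).
elim: n k => // n IHn k le_kn.
have [V [_ V_uniq]] := Pk k W.
have lower (l : 'I_s) : (l < k)%N -> W l = W' l.
  by move=> lt_lk; apply: IHn; apply: leq_trans lt_lk le_kn.
(* Both [W k] and [W' k] solve equation [k] over the stages of [W], since the two families agree
   below [k]. *)
transitivity V; [symmetry|]; apply: V_uniq.
  by apply: Pext (PW k (ltn_ord k)) => l _; rewrite ffunE; case: eqP => [->|].
apply: Pext (PW' k) => l le_lk; rewrite ffunE.
case: (eqVneq l k) => [->//|lk].
by rewrite lower // ltn_neqAle lk.
Qed.

Lemma stage_eq_lower (R : realType) (eps abar ubar lambda1 : R) (N s : nat)
    (S : imex_rk R s) (Un : grid_fun R N) (W W' : stage_fun R N s) (k : 'I_s) :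
  (forall l : 'I_s, (l <= k)%N -> W l = W' l) ->
  stage_eq eps abar ubar lambda1 S Un W k ->
  stage_eq eps abar ubar lambda1 S Un W' k.
Proof.
move=> WW' eqW i; rewrite -WW' // eqW; congr (_ - _ *: _ - _ *: _).
  by apply: eq_bigr => l lt_lk; rewrite WW' // ltnW.
by apply: eq_bigr => l le_lk; rewrite WW'.
Qed.

Lemma stage_solvable (R : realType) (eps abar ubar lambda1 : R) (N s : nat)
    (S : imex_rk R s) (Un : grid_fun R N) (k : 'I_s) (W : stage_fun R N s) :
  exists! V, stage_eq eps abar ubar lambda1 S Un (set_stage W k V) k.
Proof.
(* Here both sums stop strictly below [k]; the term [l = k] of the stiff sum becomes the unknown
   part, with [mu = lambda1 * rk_A S k k]. *)
pose B : grid_fun R N := [ffun i => Un i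
  - lambda1 *: (\sum_(l < s | (l < k)%N)
                  rk_At S k l *: flux_diff_F ubar (W l) i)
  - lambda1 *: (\sum_(l < s | (l < k)%N)
                  rk_A S k l *: flux_diff_G eps abar (W l) i)].
have stageE V : stage_eq eps abar ubar lambda1 S Un (set_stage W k V) k <->
    V + (lambda1 * rk_A S k k) *: flux_diff_G_fun eps abar V = B.
  have lower (l : 'I_s) : (l < k)%N -> set_stage W k V l = W l.
    by rewrite ffunE; case: eqP => // ->; rewrite ltnn.
  have Vk : set_stage W k V k = V by rewrite ffunE eqxx.
  have rhsE i : Un i
      - lambda1 *: (\sum_(l < s | (l < k)%N)
          rk_At S k l *: flux_diff_F ubar (set_stage W k V l) i)
      - lambda1 *: (\sum_(l < s | (l <= k)%N)
          rk_A S k l *: flux_diff_G eps abar (set_stage W k V l) i)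
      = B i - (lambda1 * rk_A S k k) *: flux_diff_G_fun eps abar V i.
    rewrite [X in _ - _ *: X = _](bigD1 k) //= Vk !ffunE.
    rewrite scalerDr scalerA opprD [- (_ *: _) - _]addrC addrA.
    congr (_ - _ *: _ - _ *: _ - _).
      by apply: eq_bigr => l lt_lk; rewrite lower.
    rewrite (eq_bigl (fun l : 'I_s => (l < k)%N)) => [|l].
      by apply: eq_bigr => l lt_lk; rewrite lower.
    by rewrite ltn_neqAle andbC.
  split=> [eqV|eqV i]; last first.
    by rewrite rhsE Vk -eqV ffunE [X in _ + X - _]ffunE addrK.
  by apply/ffunP => i; rewrite ffunE -{1}Vk eqV rhsE [X in _ + X]ffunE subrK.
have [V [PV V_uniq]] := implicit_flux_solvable eps abar (lambda1 * rk_A S k k) B.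
by exists V; split=> [|V' /stageE/V_uniq//]; apply/stageE.
Qed.

Theorem theorem5p2 (R : realType) (eps abar ubar : R)
    (heps : 0 < eps) (habar : 0 < abar)
    (N : nat) (hN : (0 < N)%N) (dx : R) (hdx : 0 < dx)
    (s : nat) (hs : (0 < s)%N) (S : imex_rk R s)
    (hS : type_A S \/ type_CK S)
    (Un : grid_fun R N) (dt : R) (hdt : 0 < dt) :
  let lambda1 := dt / dx in
  (forall (k : 'I_s) (W : stage_fun R N s),
     (forall l : 'I_s, (l < k)%N -> stage_eq eps abar ubar lambda1 S Un W l) ->
     exists! V : grid_fun R N,
       stage_eq eps abar ubar lambda1 S Un (set_stage W k V) k)
  /\ (exists! W : stage_fun R N s,
        forall k : 'I_s, stage_eq eps abar ubar lambda1 S Un W k)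
  /\ (exists! Unext : grid_fun R N,
        exists W : stage_fun R N s,
          (forall k : 'I_s, stage_eq eps abar ubar lambda1 S Un W k)
          /\ update_eq eps abar ubar lambda1 S Un W Unext).
Proof.
move=> lambda1; split=> [k W _|]; first exact: stage_solvable.
have [W [PW W_uniq]] : exists! W : stage_fun R N s,
    forall k : 'I_s, stage_eq eps abar ubar lambda1 S Un W k.
  apply: triangular_system_solvable => [W W' k|k W].
    exact: stage_eq_lower.
  exact: stage_solvable.
split; first by exists W.
(* The update is explicit in the stages, so its right-hand side at the unique [W] is the witness. *)
exists [ffun i => Un i
  - lambda1 *: (\sum_(k < s) rk_wt S 0 k *: flux_diff_F ubar (W k) i)
  - lambda1 *: (\sum_(k < s) rk_w S 0 k *: flux_diff_G eps abar (W k) i)].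
(* A competing update comes with its own stages [W'], which [W_uniq] identifies with [W]. *)
split=> [|Unext [W' [/W_uniq <- eqU]]].
  by exists W; split=> // i; rewrite ffunE.
by apply/ffunP => i; rewrite ffunE eqU.
Qed.
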